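(* Let $(\mathcal V,p,e)$ be a hyperbolic system of degree $n$ and let $\mathbf A=[a_1,a_2,\dots,a_n]$ be a $\mathcal V$-matrix. If $\mathbf A$ is $e$-doubly stochastic, then $$\lambda(\mathbf A r)\prec r\quad\text{for all } r\in\mathbb R^n,$$ where $\mathbf A r=\sum_{i=1}^n r_i a_i$. The converse holds when $p$ is complete: if $p$ is complete and $\lambda(\mathbf A r)\prec r$ for all $r\in\mathbb R^n$, then $\mathbf A$ is $e$-doubly stochastic.
   Context: A hyperbolic system $(\mathcal V,p,e)$ of degree $n$ consists of a nonzero finite-dimensional real vector space $\mathcal V$, a nonzero element $e\in\mathcal V$, and a real homogeneous polynomial $p$ of degree $n$ on $\mathcal V$ such that $p(e)\neq 0$ and, for each $x\in\mathcal V$, the univariate polynomial $t\mapsto p(te-x)$ has only real zeros. For $x\in\mathcal V$, $\lambda(x)=(\lambda_1(x),\dots,\lambda_n(x))^T\in\mathbb R^n$ is the vector of these zeros (with multiplicity) in decreasing order. The hyperbolicity cone is $\Lambda_+=\{x\in\mathcal V:\lambda(x)\ge 0\}$. The trace is $\operatorname{tr}(x)=\sum_{i=1}^n\lambda_i(x)$. The polynomial $p$ is complete if $\lambda(x)=0$ implies $x=0$. A $\mathcal V$-matrix is an $n$-tuple $\mathbf A=[a_1,\dots,a_n]$ of elements of $\mathcal V$. It is $e$-doubly stochastic if $a_i\in\Lambda_+$ and $\operatorname{tr}(a_i)=1$ for all $i$, and $a_1+\dots+a_n=e$. Majorization in $\mathbb R^n$: $r\prec s$ means $\sum_{i=1}^k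 r_i^\downarrow\le\sum_{i=1}^k s_i^\downarrow$ for all $1\le k\le n$, with equality for $k=n$, where $r^\downarrow$ is the decreasing rearrangement of $r$. *)

(* Defs.v *)
From HB Require Import structures.
From mathcomp Require Import all_boot all_order all_algebra.
From mathcomp Require Import reals.
From mathcomp Require Import complex polyrcf.
From mathcomp Require Import mpoly.

Set Implicit Arguments.
Unset Strict Implicit.
Unset Printing Implicit Defensive.

Import Order.TTheory GRing.Theory Num.Theory.

Local Open Scope ring_scope.

Definition decr_seq (R : realType) (s : seq R) : seq R := sort >=%R s.

Definition decr_rearr (R : realType) (n : nat) (r : 'cV[R]_n) : 'cV[R]_n :=
  \col_i nth 0 (decr_seq [seq r j 0 | j : 'I_n]) i.

Definition majorized (R : realType) (n : nat) (r s : 'cV[R]_n) : Prop :=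
  (forall k : nat, (1 <= k <= n)%N ->
     \sum_(i < n | (i < k)%N) decr_rearr r i 0 <=
     \sum_(i < n | (i < k)%N) decr_rearr s i 0) /\
  \sum_(i < n) decr_rearr r i 0 = \sum_(i < n) decr_rearr s i 0.

(* A polynomial on V is a multivariate polynomial in the coordinates of a      *)
(* vector relative to the fixed basis vbasis fullv.                            *)
Definition vpoly (R : realType) (V : vectType R) : Type :=
  {mpoly R[\dim {:V}]}.

Definition vcoord (R : realType) (V : vectType R) (x : V)
    (i : 'I_(\dim {:V})) : R :=
  coord (vbasis {:V}) i x.

Definition veval (R : realType) (V : vectType R) (p : vpoly V) (x : V) : R :=
  p.@[vcoord x].

(* The univariate polynomial t |-> p (t e - x), see charp_horner below. *)
Definition charp (R : realType) (V : vectType R) (p : vpoly V) (e x : V) :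
    {poly R} :=
  mmap (@polyC R) (fun i => (vcoord e i)%:P * 'X - (vcoord x i)%:P) p.

Lemma charp_horner (R : realType) (V : vectType R) (p : vpoly V) (e x : V)
    (t : R) : (charp p e x).[t] = veval p (t *: e - x).
Proof.
rewrite /charp /veval /meval /mmap horner_sum; apply: eq_bigr => m _.
rewrite hornerM hornerC; congr (_ * _).
rewrite /mmap1 horner_prod; apply: eq_bigr => i _.
rewrite horner_exp hornerD hornerN !hornerE; congr (_ ^+ _).
by rewrite /vcoord linearB linearZ /= mulrC.
Qed.

Definition only_real_zeros (R : realType) (f : {poly R}) : Prop :=
  forall z : R[i], root (map_poly (real_complex R) f) z ->
    exists t : R, z = real_complex R t.

(* V is nonzero because e is. *)
Record hyperbolic_system (R : realType) (V : vectType R) (n : nat)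
    (p : vpoly V) (e : V) : Prop := HyperbolicSystem {
  hs_direction_neq0 : e != 0;
  hs_homogeneous : p \is n.-homog;
  hs_eval_neq0 : veval p e != 0;
  hs_real_zeros : forall x : V, only_real_zeros (charp p e x) }.

(* rootsR lists each real root once. *)
Definition zeros (R : realType) (f : {poly R}) : seq R :=
  flatten [seq nseq (mup t f) t | t <- rootsR f].

(* In a hyperbolic system of degree n, zeros (charp p e x) has exactly n       *)
(* elements, so the default value of nth is never reached.                     *)
Definition eigenvalues (R : realType) (V : vectType R) (n : nat)
    (p : vpoly V) (e x : V) : 'cV[R]_n :=
  \col_i nth 0 (decr_seq (zeros (charp p e x))) i.

Definition hyp_cone (R : realType) (V : vectType R) (n : nat)
    (p : vpoly V) (e x : V) : Prop :=
  forall i : 'I_n, 0 <= eigenvalues n p e x i 0.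

Definition hyp_trace (R : realType) (V : vectType R) (n : nat)
    (p : vpoly V) (e x : V) : R :=
  \sum_(i < n) eigenvalues n p e x i 0.

Definition complete (R : realType) (V : vectType R) (n : nat)
    (p : vpoly V) (e : V) : Prop :=
  forall x : V, eigenvalues n p e x = 0 -> x = 0.

Definition doubly_stochastic (R : realType) (V : vectType R) (n : nat)
    (p : vpoly V) (e : V) (A : n.-tuple V) : Prop :=
  (forall i : 'I_n, hyp_cone n p e (tnth A i) /\
                    hyp_trace n p e (tnth A i) = 1) /\
  \sum_(i < n) tnth A i = e.

Definition Vmatrix_mul (R : realType) (V : vectType R) (n : nat)
    (A : n.-tuple V) (r : 'cV[R]_n) : V :=
  \sum_(i < n) r i 0 *: tnth A i.

(* Main.v *)
Require Import Defs.
From mathcomp Require Import all_boot all_order all_algebra.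
From mathcomp Require Import reals complex polyrcf.
From mathcomp Require Import mpoly.
From mathcomp Require Import ring lra zify.

Set Implicit Arguments.
Unset Strict Implicit.
Unset Printing Implicit Defensive.

Import Order.TTheory GRing.Theory Num.Theory.

Local Open Scope ring_scope.

(** Let [x = A r], let [f(t) = p(t e - x) = p(e) prod_j (t - l_j)], and for a
    direction [b] let [h_b(t)] be the derivative of [p] along [b] at [t e - x].
    If [b] lies in the interior of the hyperbolicity cone, Gårding's homotopy
    argument shows that the roots [s] of [p(z e - x + s b)] lie in the lower
    half-plane whenever [z] lies in the upper one, so [Im (h_b / f) <= 0] there;
    the bound passes to the closed cone.  A rational function with this property
    and real poles has only simple poles with nonnegative residues, so [h_b / f]
    is a nonnegative combination of the [1 / (t - a)], with [a] ranging over the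
    distinct eigenvalues of [x].  Call [w_i(a)] the coefficients for [b = a_i].
    Since [h_b] is linear in [b], [h_e = f'] and (Euler) [h_x = t f' - n f],
    uniqueness of partial fractions gives [sum_i w_i(a) = m_a] and
    [sum_i r_i w_i(a) = a m_a], where [m_a] is the multiplicity of [a]; comparing
    leading coefficients gives [sum_a w_i(a) = tr a_i = 1].  Hence
    [sum_j (l_j - T)^+ <= sum_i (r_i - T)^+] for every [T], which together with
    the equality of the sums is majorization.  For the converse, take for [r] the
    unit vectors and the all-ones vector. *)

(** * Restricting a polynomial to a line *)

Lemma mpoly_ring_ind (n : nat) (R : comNzRingType) (P : {mpoly R[n]} -> Prop) :
  (forall c, P c%:MP) -> (forall i, P 'X_i) ->
  (forall p q, P p -> P q -> P (p + q)) ->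
  (forall p q, P p -> P q -> P (p * q)) -> forall p, P p.
Proof.
move=> PC PX PD PM p; rewrite [p]mpolyE.
apply: (big_ind P) => [||m _]; first by rewrite -mpolyC0.
  exact: PD.
rewrite -mul_mpolyC; apply: (PM) => //; rewrite mpolyXE_id.
apply: (big_ind P) => [||i _]; first by rewrite -mpolyC1.
  exact: PM.
by elim: (m i) => [|k IH]; rewrite ?expr0 -?mpolyC1 // exprS; apply: (PM).
Qed.

Lemma dhomog_mderiv (n : nat) (R : comNzRingType) (d : nat)
    (p : {mpoly R[n]}) (i : 'I_n) :
  p \is d.-homog -> p^`M(i) \is d.-1.-homog.
Proof.
move=> /dhomogP hp; apply/dhomogP => m.
rewrite mcoeff_msupp mcoeff_mderiv => nz.
have /hp : (m + U_(i))%MM \in msupp p.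
  by rewrite mcoeff_msupp; apply: contraNneq nz => ->; rewrite mul0rn.
by rewrite /= mdegD mdeg1 addn1 => <-.
Qed.

Section Lines.

Variables (d : nat) (R : comNzRingType).

(** [phi] is a parameter because lines are taken over the reals, over [R[i]], and over [{poly
    R[i]}], where the base point depends polynomially on a homotopy parameter. *)
Definition line (S : comNzRingType) (phi : R -> S) (v w : 'I_d -> S)
    (p : {mpoly R[d]}) : {poly S} :=
  mmap (polyC \o phi) (fun i => (v i)%:P + (w i)%:P * 'X) p.

Lemma rmorph_mmap (S T : comNzRingType) (phi : R -> S)
    (psi : {rmorphism S -> T}) (v : 'I_d -> S) (p : {mpoly R[d]}) :
  psi (mmap phi v p) = mmap (psi \o phi) (psi \o v) p.
Proof.
rewrite /mmap rmorph_sum; apply: eq_bigr => m _; rewrite rmorphM; congr (_ * _).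
by rewrite /mmap1 rmorph_prod; apply: eq_bigr => i _; rewrite rmorphXn.
Qed.

Lemma mmap_eq (S : comNzRingType) (phi psi : R -> S) (v w : 'I_d -> S)
    (p : {mpoly R[d]}) : phi =1 psi -> v =1 w -> mmap phi v p = mmap psi w p.
Proof.
move=> Ep Ev; rewrite /mmap; apply: eq_bigr => m _; rewrite Ep.
by congr (_ * _); rewrite /mmap1; apply: eq_bigr => i _; rewrite Ev.
Qed.

Lemma horner_line (S : comNzRingType) (phi : R -> S) (v w : 'I_d -> S)
    (p : {mpoly R[d]}) (s : S) :
  (line phi v w p).[s] = mmap phi (fun i => v i + w i * s) p.
Proof.
rewrite -/(horner_eval s _) /line (rmorph_mmap _ (horner_eval s)).
by apply: mmap_eq => [c|i] /=; rewrite /horner_eval !hornerE.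
Qed.

Lemma map_line (S T : comNzRingType) (phi : R -> S) (psi : {rmorphism S -> T})
    (v w : 'I_d -> S) (p : {mpoly R[d]}) :
  map_poly psi (line phi v w p) = line (psi \o phi) (psi \o v) (psi \o w) p.
Proof.
rewrite /line (rmorph_mmap _ (map_poly psi)).
apply: mmap_eq => [c|i] /=; first by rewrite map_polyC.
by rewrite rmorphD rmorphM /= !map_polyC map_polyX.
Qed.

Lemma mmap_dhomog (S : comNzRingType) (phi : R -> S) (v : 'I_d -> S) (c : S)
    (n : nat) (p : {mpoly R[d]}) : p \is n.-homog ->
  mmap phi (fun i => c * v i) p = c ^+ n * mmap phi v p.
Proof.
move=> /dhomogP hp; rewrite /mmap mulr_sumr big_seq [RHS]big_seq.
apply: eq_bigr => m /hp <- /=; rewrite mulrCA; congr (_ * _).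
rewrite /mmap1 mdegE expr_sum -big_split /=.
by apply: eq_bigr => i _; rewrite exprMn.
Qed.

(** Chain rule: both sides are additive in [p] and obey the Leibniz rule, so constants and variables
    suffice. *)
Lemma deriv_line (S : comNzRingType) (phi : {rmorphism R -> S})
    (v w : 'I_d -> S) (p : {mpoly R[d]}) :
  (line phi v w p)^`() = \sum_i w i *: line phi v w (p^`M(i)).
Proof.
rewrite /line; elim/mpoly_ring_ind: p => [c|j|p q IHp IHq|p q IHp IHq].
- rewrite mmapC derivC big1 // => i _.
  by rewrite mderivC mmap0 scaler0.
- rewrite mmapX mmap1U derivD derivM !derivC derivX mul0r !add0r mulr1.
  rewrite (bigD1 j) //= big1 ?addr0 => [|i neq_ij].
    rewrite mderivX mnm1E eqxx scale1r.
    have -> : (U_(j) - U_(j))%MM = 0%MM.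
      by apply/mnmP => k; rewrite mnmBE mnm0E subnn.
    by rewrite mpolyX0 rmorph1 alg_polyC.
  rewrite mderivX mnm1E eq_sym (negbTE neq_ij) scale0r.
  by rewrite rmorph0 scaler0.
- rewrite rmorphD derivD IHp IHq -big_split; apply: eq_bigr => i _.
  by rewrite mderivD rmorphD scalerDr.
- rewrite rmorphM derivM IHp IHq mulr_suml mulr_sumr -big_split /=.
  apply: eq_bigr => i _; rewrite mderivM rmorphD !rmorphM /= scalerDr.
  by rewrite scalerAl scalerAr.
Qed.

End Lines.

(* [D] is the reversal [u^a C(1/u)]; this is how homogeneity of [p] gives the
   degree and the leading coefficients of its restriction to a line. *)
Section Reversal.

Variables (K : numFieldType) (a : nat) (C D : {poly K}).

Hypothesis CD : forall u, u != 0 -> C.[u^-1] * u ^+ a = D.[u].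

Lemma poly_ext_neq0 (p q : {poly K}) :
  (forall u, u != 0 -> p.[u] = q.[u]) -> p = q.
Proof.
move=> E; apply/eqP; rewrite -subr_eq0; apply/eqP.
pose rs : seq K := [seq i.+1%:R | i <- iota 0 (size (p - q))].
apply: (@roots_geq_poly_eq0 _ _ rs); last by rewrite size_map size_iota.
- apply/allP => _ /mapP[i _ ->]; apply/rootP.
  by rewrite hornerD hornerN E ?subrr // pnatr_eq0.
- rewrite map_inj_uniq ?iota_uniq // => i j /eqP.
  by rewrite eqr_nat => /eqP[].
Qed.

(** The factor ['X^(size C)] keeps all exponents natural while [a] is not yet known to bound the
    degree of [C]. *)
Lemma reversal_eq : 'X^(size C) * D =
  \sum_(j < size C) C`_j *: 'X^(a + (size C - j)).
Proof.
apply: poly_ext_neq0 => u u0; rewrite hornerM hornerXn -CD //.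
rewrite horner_coef horner_sum mulr_suml mulr_sumr; apply: eq_bigr => j _.
rewrite hornerZ hornerXn exprVn exprD exprB ?unitfE ?(ltnW (ltn_ord j)) //.
by rewrite mulrCA -!mulrA; congr (_ * _); rewrite mulrA mulrC [u ^- j * _]mulrC.
Qed.

Lemma coef_reversal k : (k <= a)%N -> C`_(a - k) = D`_k.
Proof.
move=> ka; have /(congr1 (fun q : {poly K} => q`_(size C + k))) := reversal_eq.
rewrite coefXnM ltnNge leq_addr /= addKn => ->; rewrite coef_sum.
have [lt|ge] := ltnP (a - k) (size C).
  rewrite (bigD1 (Ordinal lt)) //= big1 ?addr0 => [|j neq].
    rewrite coefZ coefXn; suff -> : (size C + k)%N = (a + (size C - (a - k)))%N.
      by rewrite eqxx mulr1.
    lia.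
  rewrite coefZ coefXn; case: eqP => [eq|]; last by rewrite mulr0.
  case/eqP: neq; apply: val_inj => /=; have := ltn_ord j; lia.
rewrite nth_default // big1 // => j _.
rewrite coefZ coefXn; case: eqP => [eq|]; last by rewrite mulr0.
by exfalso; move: ge eq (ltn_ord j) => /=; lia.
Qed.

Lemma size_reversal : (size C <= a.+1)%N.
Proof.
apply/leq_sizeP => j ja.
have [lt|/(nth_default _) //] := ltnP j (size C).
(* A coefficient of [C] of index [j > a] would sit at exponent [size C - (j - a)], below [size C],
   where the left side has no term. *)
have /(congr1 (fun q : {poly K} => q`_(size C - (j - a)))) := reversal_eq.
rewrite coefXnM ltn_subrL (leq_ltn_trans _ lt) // subn_gt0 ja /= coef_sum.
rewrite (bigD1 (Ordinal lt)) //= big1 ?addr0 => [|i neq].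
  rewrite coefZ coefXn; suff -> : (size C - (j - a))%N = (a + (size C - j))%N.
    by rewrite eqxx mulr1 => <-.
  lia.
rewrite coefZ coefXn; case: eqP => [eq|]; last by rewrite mulr0.
case/eqP: neq; apply: val_inj => /=; have := ltn_ord i; lia.
Qed.

End Reversal.

Section LineHomog.

Variables (d : nat) (R : comNzRingType) (K : numFieldType).
Variables (phi : R -> K) (n : nat) (p : {mpoly R[d]}).
Hypothesis hp : p \is n.-homog.
Implicit Types v w : 'I_d -> K.

Let line_rev v w u : u != 0 ->
  (line phi v w p).[u^-1] * u ^+ n = (line phi w v p).[u].
Proof.
move=> u0; rewrite !horner_line mulrC -(mmap_dhomog _ _ _ hp).
apply: mmap_eq => // i; rewrite mulrDr mulrCA divff // mulr1.
by rewrite addrC mulrC.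
Qed.

Lemma size_line v w : (size (line phi v w p) <= n.+1)%N.
Proof. exact: size_reversal (@line_rev v w). Qed.

Lemma coef_line v w k : (k <= n)%N ->
  (line phi v w p)`_(n - k) = (line phi w v p)`_k.
Proof. exact: coef_reversal (@line_rev v w) k. Qed.

Lemma coef_line_lead v w : (line phi v w p)`_n = mmap phi w p.
Proof.
rewrite -{1}(subn0 n) coef_line // -horner_coef0 horner_line.
by apply: mmap_eq => // i; rewrite mulr0 addr0.
Qed.

End LineHomog.

(** * Zeros of real polynomials and majorization *)

Section RealZeros.

Variable R : realType.
Implicit Types (f : {poly R}) (s : seq R).

(** [R[i]] supplies a root, the hypothesis makes it real, and its linear factor is split off by
    induction on the size. *)
Lemma only_real_zeros_split f : f != 0 -> only_real_zeros f ->
  exists s, f = lead_coef f *: \prod_(a <- s) ('X - a%:P).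
Proof.
have [m] := ubnP (size f); elim: m f => // m IH f; rewrite ltnS => le_m f0 rf.
have [sz1|] := boolP (size f == 1%N).
  exists [::]; rewrite big_nil alg_polyC; have := size1_polyC (eq_leq (eqP sz1)).
  by move=> {1}->; rewrite lead_coefE (eqP sz1).
rewrite -(size_map_poly (real_complex R)) => /closed_rootP[z rz].
have [t Dz] := rf z rz; move: rz; rewrite Dz fmorph_root.
move=> /factor_theorem[q Df].
have q0 : q != 0 by apply: contraNneq f0 => q0; rewrite Df q0 mul0r.
have [||x rx|s Dq] := IH q.
- by move: le_m; rewrite Df size_Mmonic ?monicXsubC // size_XsubC addn2.
- by [].
- by apply: rf; rewrite Df rmorphM rootM rx.
exists (t :: s); rewrite {2}Df lead_coefM lead_coefXsubC mulr1 big_cons.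
by rewrite {1}Df {1}Dq -scalerAl mulrC.
Qed.

Lemma mup_prod_XsubC s (a : R) :
  mup a (\prod_(b <- s) ('X - b%:P)) = count_mem a s.
Proof.
elim: s => [|b s IH]; first by rewrite big_nil mupNroot // root1.
rewrite big_cons mupM ?polyXsubC_eq0 ?monic_neq0 ?monic_prod_XsubC //=.
by rewrite IH -['X - b%:P]expr1 mup_XsubCX eq_sym; case: eqVneq.
Qed.

Lemma count_mem_flatten_nseq (T : eqType) (m : T -> nat) (l : seq T) (a : T) :
  uniq l -> count_mem a (flatten [seq nseq (m t) t | t <- l]) =
            if a \in l then m a else 0%N.
Proof.
elim: l => //= b l IH /andP[bl /IH {}IH].
rewrite count_cat count_nseq IH inE /= [a == b]eq_sym.
by case: eqVneq => [<-|_]; rewrite ?(negbTE bl) ?mul1n ?addn0 // mul0n.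
Qed.

Lemma perm_zeros (c : R) s : c != 0 ->
  perm_eq (zeros (c *: \prod_(a <- s) ('X - a%:P))) s.
Proof.
move=> c0; set f := c *: _.
have f0 : f != 0 by rewrite scaler_eq0 negb_or c0 monic_neq0 ?monic_prod_XsubC.
apply/allP => a _ /=; rewrite /zeros count_mem_flatten_nseq ?uniq_roots //.
have := roots_on_rootsR f0 a; rewrite in_itv /= => <-.
have <- : mup a f = count_mem a s.
  by rewrite /f -mul_polyC mupMr ?mup_prod_XsubC // rootC.
by case: ifPn => // /mupNroot ->.
Qed.

Lemma eq_decr_seq s1 s2 :
  perm_eq s1 s2 -> decr_seq s1 = decr_seq s2.
Proof.
move=> h; apply/perm_sortP => //.
- exact: ge_total.
- exact: ge_trans.
- exact: ge_anti.
Qed.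

Lemma sorted_decr_seq s : sorted >=%R (decr_seq s).
Proof. by apply: sort_sorted; exact: ge_total. Qed.

Lemma decr_seq_id s : sorted >=%R s -> decr_seq s = s.
Proof. by apply: sorted_sort; exact: ge_trans. Qed.

Lemma size_decr_seq s : size (decr_seq s) = size s.
Proof. exact: size_sort. Qed.

Lemma perm_decr_seq s : perm_eq (decr_seq s) s.
Proof. by rewrite perm_sort. Qed.

Lemma sorted_ge_nth s (i j : nat) : sorted >=%R s -> (i <= j < size s)%N ->
  nth 0 s j <= nth 0 s i.
Proof.
move=> ss /andP[ij js].
apply: (sorted_leq_nth (@ge_trans _ R) (@ge_refl _ R) 0 ss) => //.
by rewrite inE (leq_ltn_trans ij).
Qed.

Lemma sum_decr_rearr (n : nat) (F : R -> R) (y : 'cV[R]_n) :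
  \sum_i F (decr_rearr y i 0) = \sum_i F (y i 0).
Proof.
pose s := [seq y j 0 | j : 'I_n].
have sz : size (decr_seq s) = n by rewrite size_decr_seq size_map size_enum_ord.
transitivity (\sum_(a <- decr_seq s) F a).
  by rewrite (big_nth 0) sz big_mkord; apply: eq_bigr => i _; rewrite mxE.
by rewrite (perm_big _ (perm_decr_seq s)) /= big_map big_enum.
Qed.

Lemma decr_rearr_mono (n : nat) (y : 'cV[R]_n) (i j : 'I_n) : (i <= j)%N ->
  decr_rearr y j 0 <= decr_rearr y i 0.
Proof.
move=> ij; rewrite !mxE sorted_ge_nth ?sorted_decr_seq //.
by rewrite size_decr_seq size_map size_enum_ord ij /=.
Qed.

Lemma decr_rearr_surj (n : nat) (y : 'cV[R]_n) (i : 'I_n) :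
  exists j, y i 0 = decr_rearr y j 0.
Proof.
pose s := [seq y j 0 | j : 'I_n].
have : y i 0 \in decr_seq s.
  by rewrite (perm_mem (perm_decr_seq s)); apply/imageP; exists i.
case/(nthP 0) => j; rewrite size_decr_seq size_map size_enum_ord => jn <-.
by exists (Ordinal jn); rewrite mxE.
Qed.

Lemma decr_rearr_mem (n : nat) (y : 'cV[R]_n) (i : 'I_n) :
  exists j, decr_rearr y i 0 = y j 0.
Proof.
pose s := [seq y j 0 | j : 'I_n].
have : decr_rearr y i 0 \in s.
  rewrite -(perm_mem (perm_decr_seq s)) mxE mem_nth //.
  by rewrite size_decr_seq size_map size_enum_ord.
by case/imageP => j _ ->; exists j.
Qed.

Lemma majorized_sum (n : nat) (x r : 'cV[R]_n) :
  majorized x r -> \sum_i x i 0 = \sum_i r i 0.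
Proof. by case=> _; rewrite (sum_decr_rearr id) (sum_decr_rearr id). Qed.

Lemma majorized_le (n : nat) (x r : 'cV[R]_n) (M : R) : majorized x r ->
  (forall i, r i 0 <= M) -> forall i, x i 0 <= M.
Proof.
case: n x r => [x r _ _ []//|n] x r [maj _] rM i.
have top (y : 'cV[R]_n.+1) :
    \sum_(i < n.+1 | (i < 1)%N) decr_rearr y i 0 = decr_rearr y ord0 0.
  by rewrite (big_pred1 ord0) // => j; rewrite ltnS leqn0.
have := maj 1%N isT; rewrite !top => xr0.
 have [j ->] := decr_rearr_surj x i.
apply: le_trans (decr_rearr_mono x (leq0n j : (ord0 <= j)%N)) _.
by have [k Ek] := decr_rearr_mem r ord0; apply: le_trans xr0 _; rewrite Ek.
Qed.

(** With equal totals, the bound on the sum of all entries but the smallest reverses into a bound on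
    the smallest entries. *)
Lemma majorized_ge (n : nat) (x r : 'cV[R]_n) (m : R) : majorized x r ->
  (forall i, m <= r i 0) -> forall i, m <= x i 0.
Proof.
case: n x r => [x r _ _ []//|n] x r [maj Esum] mr i.
have xr : \sum_(i < n.+1 | (i < n)%N) decr_rearr x i 0 <=
    \sum_(i < n.+1 | (i < n)%N) decr_rearr r i 0.
  (* Partial sums start at length one; in dimension one both sums here are empty. *)
  case: n x r maj {Esum mr i} => [|n] x r maj; last by apply: maj; rewrite /= leqnSn.
  by rewrite !big1.
have [j ->] := decr_rearr_surj x i.
apply: le_trans (decr_rearr_mono x (leq_ord j : (j <= @ord_max n)%N)).
have [k Ek] := decr_rearr_mem r ord_max; apply: le_trans (mr k) _; rewrite -Ek.
have split (y : 'cV[R]_n.+1) : \sum_i decr_rearr y i 0 =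
    \sum_(i < n.+1 | (i < n)%N) decr_rearr y i 0 + decr_rearr y ord_max 0.
  rewrite (bigID (fun i : 'I_n.+1 => (i < n)%N)) /=; congr (_ + _).
  rewrite (bigD1 ord_max) ?ltnn //= big1 ?addr0 // => l /andP[].
  rewrite -leqNgt => nl /eqP[]; apply: val_inj => /=; apply/eqP.
  by rewrite eqn_leq nl -ltnS ltn_ord.
move: Esum; rewrite !split => Esum.
by rewrite -(lerD2l (\sum_(i < n.+1 | (i < n)%N) decr_rearr r i 0)) -Esum lerD2r.
Qed.

(** Take [T] to be the last of the [k] largest entries of [r]. The hinge sum of [r] is then exactly
    the excess of these entries over [T], while that of [x] is at least the excess of its [k]
    largest. *)
Lemma majorized_hinge (n : nat) (x r : 'cV[R]_n) :
  \sum_i x i 0 = \sum_i r i 0 ->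
  (forall T, \sum_i Num.max (x i 0 - T) 0 <= \sum_i Num.max (r i 0 - T) 0) ->
  majorized x r.
Proof.
move=> Exr hinge; split=> [k /andP[k0 kn]|]; last first.
  by rewrite (sum_decr_rearr id) (sum_decr_rearr id).
case: k k0 kn => // k _ kn; pose T := decr_rearr r (Ordinal kn) 0.
have decr i : (T <= decr_rearr r i 0) || ~~ (i < k.+1)%N.
  have [ik|] := ltnP i k.+1; last by rewrite orbT.
  rewrite orbF /T !mxE /=.
  apply: sorted_ge_nth; first exact: sorted_decr_seq.
  by rewrite size_decr_seq size_map size_enum_ord kn -ltnS ik.
have decr' (i : 'I_n) : ~~ (i < k.+1)%N -> decr_rearr r i 0 <= T.
  rewrite -leqNgt => ki; rewrite /T !mxE /=.
  apply: sorted_ge_nth; first exact: sorted_decr_seq.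
  by rewrite size_decr_seq size_map size_enum_ord ltn_ord ltnW.
have shift (y : 'cV[R]_n) : \sum_(i < n | (i < k.+1)%N) y i 0 =
    \sum_(i < n | (i < k.+1)%N) T + \sum_(i < n | (i < k.+1)%N) (y i 0 - T).
  by rewrite -big_split /=; apply: eq_bigr => i _; rewrite addrC subrK.
rewrite shift [leRHS]shift lerD2l.
apply: (@le_trans _ _ (\sum_i Num.max (decr_rearr x i 0 - T) 0)).
  rewrite big_mkcond; apply: ler_sum => i _.
  by case: ifP => _; rewrite le_max ?lexx ?orbT.
rewrite (sum_decr_rearr (fun a => Num.max (a - T) 0)) (le_trans (hinge T)) //.
rewrite -(sum_decr_rearr (fun a => Num.max (a - T) 0)) [leRHS]big_mkcond.
apply: ler_sum => i _; case: ifPn => ik.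
  by have := decr i; rewrite ik orbF => Ti; rewrite max_l ?subr_ge0.
by rewrite max_r // subr_le0 decr'.
Qed.

End RealZeros.

(** * Eigenvalues *)

Lemma charp_line (R : realType) (V : vectType R) (p : vpoly V) (e x : V) :
  charp p e x = line idfun (fun i => - vcoord x i) (vcoord e) p.
Proof.
rewrite /charp /line; apply: mmap_eq => // i.
by rewrite polyCN addrC.
Qed.

Section Eigenvalues.

Variables (R : realType) (V : vectType R) (n : nat) (p : vpoly V) (e : V).
Hypothesis hyp : hyperbolic_system n p e.

Let hp := hs_homogeneous hyp.
Let pe0 := hs_eval_neq0 hyp.

Lemma coef_charp_lead x : (charp p e x)`_n = veval p e.
Proof. by rewrite charp_line (coef_line_lead _ hp). Qed.

Lemma size_charp x : size (charp p e x) = n.+1.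
Proof.
apply/eqP; rewrite eqn_leq charp_line (size_line _ hp) -charp_line /=.
rewrite ltnNge; apply: contraNN pe0 => /leq_sizeP/(_ n (leqnn n)).
by rewrite coef_charp_lead => ->.
Qed.

Lemma lead_coef_charp x : lead_coef (charp p e x) = veval p e.
Proof. by rewrite lead_coefE size_charp coef_charp_lead. Qed.

Lemma eigenvaluesE x s : charp p e x = veval p e *: \prod_(a <- s) ('X - a%:P) ->
  forall i, eigenvalues n p e x i 0 = nth 0 (decr_seq s) i.
Proof.
by move=> Ef i; rewrite mxE Ef (eq_decr_seq (perm_zeros _ pe0)).
Qed.

Lemma eigenvaluesP x : exists s, [/\ size s = n, sorted >=%R s,
  charp p e x = veval p e *: \prod_(a <- s) ('X - a%:P) &
  forall i, eigenvalues n p e x i 0 = nth 0 s i].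
Proof.
have f0 : charp p e x != 0 by rewrite -size_poly_eq0 size_charp.
have [s Ef] := only_real_zeros_split f0 (@hs_real_zeros _ _ _ _ _ hyp x).
rewrite lead_coef_charp in Ef.
have Es : charp p e x = veval p e *: \prod_(a <- decr_seq s) ('X - a%:P).
  by rewrite Ef (perm_big _ (perm_decr_seq s)).
exists (decr_seq s); split => //; last exact: eigenvaluesE.
- have := size_charp x; rewrite Es size_scale // size_prod_XsubC => -[] //.
- exact: sorted_decr_seq.
Qed.

(** This serves both to move a cone element into the interior and to subtract [e] in the
    converse. *)
Lemma charp_shift x (c : R) s :
  charp p e x = veval p e *: \prod_(a <- s) ('X - a%:P) ->
  charp p e (x + c *: e) =
    veval p e *: \prod_(a <- [seq a + c | a <- s]) ('X - a%:P).
Proof.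
move=> Es; apply: poly_ext_neq0 => t _; rewrite charp_horner.
have -> : t *: e - (x + c *: e) = (t - c) *: e - x.
  by rewrite scalerBl opprD addrA addrAC.
rewrite -charp_horner Es !hornerZ !horner_prod big_map; congr (_ * _).
by apply: eq_bigr => a _; rewrite !hornerE; ring.
Qed.

Lemma eigenvalues_subr x : (forall i, eigenvalues n p e x i 0 = 1) ->
  eigenvalues n p e (x - e) = 0.
Proof.
move=> x1; have [s [sz _ Es Ex]] := eigenvaluesP x.
have Es1 : s = nseq n 1.
  apply: (@eq_from_nth _ 0) => [|i]; rewrite sz ?size_nseq // => ni.
  by rewrite nth_nseq ni -(Ex (Ordinal ni)) x1.
apply/matrixP => i j; rewrite ord1 [RHS]mxE -scaleN1r.
rewrite (eigenvaluesE (charp_shift _ Es)) Es1 map_nseq subrr.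
rewrite decr_seq_id ?nth_nseq ?ltn_ord //.
by elim: (n) => //= -[|m] //= ->; rewrite lexx.
Qed.

Lemma majorized_doubly_stochastic (A : n.-tuple V) : complete n p e ->
  (forall r : 'cV[R]_n, majorized (eigenvalues n p e (Vmatrix_mul A r)) r) ->
  doubly_stochastic p e A.
Proof.
move=> cp maj; split=> [i|].
  have := maj (\col_k (k == i)%:R); rewrite /Vmatrix_mul (bigD1 i) //= big1.
    rewrite mxE eqxx scale1r addr0 => maji; split.
      move=> j; apply: (majorized_ge maji) => k.
      by rewrite mxE ler0n.
    rewrite /hyp_trace (majorized_sum maji) (bigD1 i) //= big1 => [|k].
      by rewrite mxE eqxx addr0.
    by rewrite mxE => /negbTE ->.
  by move=> k /negbTE ki; rewrite mxE ki scale0r.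
have := maj (const_mx 1); have -> : Vmatrix_mul A (const_mx 1) = \sum_i tnth A i.
  by apply: eq_bigr => i _; rewrite mxE scale1r.
(* Majorization by the all-ones vector forces every eigenvalue of the sum to be 1, so those of its
   difference with [e] vanish and completeness applies. *)
move=> maj1; apply/subr0_eq/cp/eigenvalues_subr => i; apply/le_anti.
rewrite (majorized_le maj1) ?(majorized_ge maj1) // => j.
  by rewrite mxE.
by rewrite mxE.
Qed.

End Eigenvalues.

(** * Root location under homotopy *)

(** Connectedness of the unit interval: [P] is locally constant, so the supremum of the [x] with [P]
    true on all of [[0, x]] belongs to this set and cannot be smaller than 1. *)
Lemma segment_ind (R : realType) (P : R -> Prop) :
  (forall x, 0 <= x <= 1 -> exists2 dl, 0 < dl &
     forall y, 0 <= y <= 1 -> `|y - x| < dl -> P x <-> P y) ->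
  P 0 -> P 1.
Proof.
move=> loc P0.
pose E : classical_sets.set R :=
  fun x => 0 <= x <= 1 /\ forall y, 0 <= y <= x -> P y.
have E0 : E 0.
  split=> [|y]; first by rewrite lexx ler01.
  by move=> /le_anti <-.
have supE : classical_sets.has_sup E.
  by split; [exists 0 | exists 1 => x [/andP[]]].
have s0 : 0 <= sup E by apply: ub_le_sup => //; case: supE.
have s1 : sup E <= 1.
  by apply: ge_sup; [exists 0 | move=> x [/andP[]]].
have [|dl dl0 sP] := loc (sup E); first by rewrite s0.
have [x Ex xs] := sup_adherent dl0 supE.
have xle : x <= sup E by apply: ub_le_sup => //; case: supE.
have Ps : P (sup E).
  apply/(sP x); [by case: Ex | by rewrite distrC ger0_norm ?subr_ge0 //; lra |].
  by case: Ex => /andP[x0 _]; apply; rewrite x0 lexx.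
pose y := Num.min 1 (sup E + dl / 2).
have Ey : E y.
  split; first by rewrite le_min ge_min lexx ler01 /=; lra.
  move=> z /andP[z0]; rewrite le_min => /andP[z1 zs].
  have [zx|xz] := lerP z x; first by case: Ex => _; apply; rewrite z0.
  apply/(sP z) => //; first by rewrite z0.
  by rewrite ltr_norml; apply/andP; split; lra.
have : y <= sup E by apply: ub_le_sup => //; case: supE.
rewrite ge_min => /orP[s1'|]; last by lra.
by have <- : sup E = 1 by apply/le_anti; rewrite s1.
Qed.

(** Continuity in quantitative form, by induction along Horner's scheme. *)
Lemma poly_local_lipschitz (K : numFieldType) (q : {poly K}) (x : K) :
  exists2 M, 0 <= M &
    forall y, `|y - x| <= 1 -> `|q.[y] - q.[x]| <= M * `|y - x|.
Proof.
elim/poly_ind: q => [|q c [M M0 IH]].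
  by exists 0 => // y _; rewrite !horner0 subrr normr0 mul0r.
exists (`|q.[x]| + M + M * `|x|) => [|y yx].
  by rewrite !addr_ge0 ?mulr_ge0.
rewrite !hornerE.
have -> : q.[y] * y + c - (q.[x] * x + c) =
          (q.[x] + (q.[y] - q.[x])) * (y - x) + (q.[y] - q.[x]) * x by ring.
rewrite (le_trans (ler_normD _ _)) // !normrM [leRHS]mulrDl; apply: lerD.
  rewrite ler_wpM2r // (le_trans (ler_normD _ _)) // lerD2l.
  by rewrite (le_trans (IH _ yx)) // ler_piMr.
by rewrite mulrAC ler_wpM2r // IH.
Qed.

Section Homotopy.

Variable R : realType.
Local Notation C := (R[i]).
Local Notation Im := (@complex.Im R).
Local Notation RC := (real_complex R).

Lemma normc_ge_Im (z : C) : (`|Im z|)%:C%C <= `|z|.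
Proof.
have := normc_ge_Re (z * 'i%C); rewrite ReiNIm normrN normrM.
by rewrite [`|'i%C|]normc_def /= expr0n expr1n add0r sqrtr1 mulr1.
Qed.

(** From [|z - r| >= - Im r] and [|z| <= |z - r| + |r|], each factor is at least a constant times
    [1 + |z|]. Uniformity in [z] lets this beat a perturbation growing like [(1 + |z|)^n]. *)
Lemma prod_lower_bound (rs : seq C) : (forall r, r \in rs -> Im r < 0) ->
  exists2 k : C, 0 < k & forall z, 0 <= Im z ->
    k * (1 + `|z|) ^+ size rs <= `|\prod_(r <- rs) (z - r)|.
Proof.
elim: rs => [_|r rs IH Him].
  by exists 1 => // z _; rewrite big_nil mul1r normr1.
have [|k k0 Hk] := IH.
  by move=> x xrs; apply: Him; rewrite inE xrs orbT.
have r0 : Im r < 0 by apply: Him; rewrite mem_head.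
pose rho : C := RC (- Im r).
have rho0 : 0 < rho by rewrite ltcR oppr_gt0.
have den0 : 0 < rho + `|r| + 1 by rewrite addr_gt0 ?ltr_wpDr.
exists (rho / (rho + `|r| + 1) * k) => [|z z0].
  by rewrite !mulr_gt0 ?invr_gt0.
rewrite big_cons normrM exprS mulrACA; apply: ler_pM => //.
- by rewrite mulr_ge0 ?divr_ge0 ?addr_ge0 // ltW.
- by rewrite mulr_ge0 ?exprn_ge0 ?addr_ge0 // ltW.
- have h1 : rho <= `|z - r|.
    apply: le_trans (normc_ge_Im _); rewrite lecR raddfB /= ger0_norm; lra.
  have h2 : `|z| <= `|z - r| + `|r| by rewrite -{1}(subrK r z) ler_normD.
  rewrite mulrAC ler_pdivrMr //.
  apply: (@le_trans _ _ (rho * (1 + (`|z - r| + `|r|)))).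
    by rewrite ler_wpM2l ?(ltW rho0) // lerD2l.
  have -> : rho * (1 + (`|z - r| + `|r|)) =
            `|z - r| * rho + rho * (`|r| + 1) by ring.
  rewrite -[rho + _ + _]addrA [leRHS]mulrDr lerD2l ler_wpM2r // addr_ge0 //.
- exact: Hk.
Qed.

(** Each factor is at least [Im z], so the bound is common to all polynomials of a given degree with
    roots below the axis. *)
Lemma prod_lower_bound_pt (rs : seq C) (z : C) : 0 < Im z ->
  (forall r, r \in rs -> Im r < 0) ->
  RC (Im z) ^+ size rs <= `|\prod_(r <- rs) (z - r)|.
Proof.
move=> z0; elim: rs => [_|r rs IH Him]; first by rewrite big_nil normr1.
have r0 : Im r < 0 by apply: Him; rewrite mem_head.
rewrite big_cons normrM exprS; apply: ler_pM.
- by rewrite ler0c ltW.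
- by rewrite exprn_ge0 // ler0c ltW.
- by apply: le_trans (normc_ge_Im _); rewrite lecR raddfB /= ger0_norm; lra.
- by apply: IH => x xrs; apply: Him; rewrite inE xrs orbT.
Qed.

Lemma real_complex_small (A M : C) : 0 < A -> 0 <= M ->
  exists2 dl : R, 0 < dl <= 1 & forall x, `|x| < dl -> M * `|RC x| < A.
Proof.
move=> A0 M0; have M10 : 0 < M + 1 by rewrite ltr_wpDl.
(* The [+ 1] covers [M = 0]; positive elements of [R[i]] are real, so the real part of [D] can serve
   as a radius. *)
pose D := A / (M + 1); have D0 : 0 < D by rewrite divr_gt0.
have ED : RC (complex.Re D) = D by rewrite RRe_real ?gtr0_real.
have Re0 : 0 < complex.Re D by move: D0; rewrite -{1}ED ltcR.
exists (Num.min 1 (complex.Re D)); first by rewrite lt_min ltr01 Re0 ge_min lexx.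
move=> x; rewrite lt_min => /andP[_ xD].
have xD' : `|RC x| < D.
  by rewrite -ED normc_def /= expr0n addr0 sqrtr_sqr ltcR.
apply: (@le_lt_trans _ _ ((M + 1) * `|RC x|)).
  by rewrite ler_wpM2r // lerDl.
by move: xD'; rewrite /D ltr_pdivlMr // mulrC.
Qed.

(* The set of [g] whose roots all lie in the open lower half-plane is closed,
   and so is its complement, because no root ever crosses the real axis. *)
Lemma homotopy_lower_half (n : nat) (c : C) (S : R -> {poly C}) : c != 0 ->
  (forall g, (size (S g) <= n.+1)%N) -> (forall g, (S g)`_n = c) ->
  (forall k, exists q : {poly C}, forall g, (S g)`_k = q.[RC g]) ->
  (forall g x, 0 <= g <= 1 -> ~~ root (S g) (RC x)) ->
  (forall z, root (S 0) z -> Im z < 0) -> forall z, root (S 1) z -> Im z < 0.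
Proof.
move=> c0 szS leadS polS realS.
pose P g := forall z, root (S g) z -> Im z < 0.
rewrite -/(P 0) -/(P 1); apply: segment_ind => g g01.
have splitS h : exists2 rs, size rs = n & S h = c *: \prod_(r <- rs) ('X - r%:P).
  have sz : size (S h) = n.+1.
    apply/eqP; rewrite eqn_leq szS ltnNge; apply: contraNN c0.
    by move=> /leq_sizeP/(_ n (leqnn n)); rewrite leadS => ->.
  have [rs Ers] := closed_field_poly_normal (S h).
  rewrite lead_coefE sz leadS in Ers; exists rs => //.
  by move: sz; rewrite Ers size_scale // size_prod_XsubC => -[].
have evalS h rs z : S h = c *: \prod_(r <- rs) ('X - r%:P) ->
    (S h).[z] = c * \prod_(r <- rs) (z - r).
  move=> ->; rewrite hornerZ horner_prod; congr (_ * _).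
  by apply: eq_bigr => r _; rewrite !hornerE.
have rootS h rs r : S h = c *: \prod_(r <- rs) ('X - r%:P) ->
    r \in rs -> root (S h) r.
  by move=> ->; rewrite rootZ // root_prod_XsubC.
(* The coefficients are polynomial in the parameter, hence Lipschitz near [g]; adding them up gives
   the weight [(1 + |z|)^n]. *)
have [M M0 lipS] : exists2 M : C, 0 <= M & forall h, `|h - g| <= 1 -> forall z,
    `|(S h).[z] - (S g).[z]| <= M * `|RC (h - g)| * (1 + `|z|) ^+ n.
  have lip N : (N <= n.+1)%N -> exists2 M : C, 0 <= M &
      forall h, `|h - g| <= 1 -> forall z,
      `|\sum_(k < N) ((S h)`_k - (S g)`_k) * z ^+ k|
        <= M * `|RC (h - g)| * (1 + `|z|) ^+ n; last first.
    have [M M0 HM] := lip n.+1 (leqnn _).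
    exists M => // h hg z; apply: le_trans (HM h hg z).
    rewrite !(horner_coef_wide _ (szS _)) -sumrB /=.
    by under eq_bigr do rewrite -mulrBl.
  elim: N => [_|N IH leN].
    by exists 0 => // h _ z; rewrite big_ord0 normr0 !mul0r.
  have [M M0 HM] := IH (ltnW leN).
  have [q Eq] := polS N; have [M' M'0 HM'] := poly_local_lipschitz q (RC g).
  exists (M + M'); first exact: addr_ge0.
  move=> h hg z; rewrite big_ord_recr /= (le_trans (ler_normD _ _)) //.
  rewrite (mulrDl M) [leRHS]mulrDl lerD ?HM // normrM normrX ler_pM ?exprn_ge0 //.
    rewrite !Eq rmorphB /=; apply: HM'.
    by rewrite -rmorphB normc_def /= expr0n addr0 sqrtr_sqr lecR.
  have z1 : 1 <= 1 + `|z| by rewrite lerDl.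
  apply: (@le_trans _ _ ((1 + `|z|) ^+ N)).
    by rewrite lerXn2r ?nnegrE ?addr_ge0 // lerDr.
  by apply: ler_weXn2l => //.
(* If [P g] holds, a root of [S h] in the closed upper half-plane would make [S g] there both small
   by [lipS] and large by [prod_lower_bound]. *)
have [Pg|nPg] := boolp.EM (P g).
  have [rs szrs Ers] := splitS g.
  have [|k k0 Hk] := @prod_lower_bound rs.
    by move=> r rrs; apply: Pg; apply: rootS Ers rrs.
  have ck0 : 0 < `|c| * k by rewrite mulr_gt0 ?normr_gt0.
  have [dl /andP[dl0 dl1] Hdl] := real_complex_small ck0 M0.
  exists dl => // h _ hg; split=> // _ z /rootP Sz.
  rewrite ltNge; apply/negP => z0.
  have := lipS h (le_trans (ltW hg) dl1) z.
  rewrite Sz sub0r normrN (evalS _ _ _ Ers) normrM => le1.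
  have := ler_wpM2l (normr_ge0 c) (Hk z z0); rewrite szrs mulrA => le2.
  have := le_trans le2 le1; rewrite ler_pM2r ?exprn_gt0 ?ltr_wpDr //.
  by move=> /le_lt_trans/(_ (Hdl _ hg)); rewrite ltxx.
(* Otherwise [S g] has a root in the closed upper half-plane, strictly above the axis since no root
   is real. If [P h] held, [S h] could not be small at this point, although [h] is close to [g]. *)
have [z /rootP Sz z0] : exists2 z, root (S g) z & 0 < Im z.
  apply: boolp.contrapT => nz; apply: nPg => z rz; rewrite ltNge; apply/negP.
  rewrite le_eqVlt => /orP[/eqP z0|z0]; last by apply: nz; exists z.
  have Ez : z = RC (complex.Re z) by apply/eqP; rewrite eq_complex /= z0 !eqxx.
  by have := realS g (complex.Re z) g01; rewrite -Ez rz.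
have A0 : 0 < `|c| * RC (Im z) ^+ n / (1 + `|z|) ^+ n.
  by rewrite !mulr_gt0 ?invr_gt0 ?exprn_gt0 ?normr_gt0 ?ltcR ?ltr_wpDr.
have [dl /andP[dl0 dl1] Hdl] := real_complex_small A0 M0.
exists dl => // h _ hg; split=> // Ph; exfalso.
have [rs szrs Ers] := splitS h.
have := lipS h (le_trans (ltW hg) dl1) z.
rewrite Sz subr0 (evalS _ _ _ Ers) normrM => le1.
have le2 : `|c| * RC (Im z) ^+ n <= `|c| * `|\prod_(r <- rs) (z - r)|.
  rewrite ler_wpM2l // -szrs prod_lower_bound_pt // => r rrs.
  by apply: Ph; apply: rootS Ers rrs.
have := le_trans le2 le1; rewrite -ler_pdivrMr ?exprn_gt0 ?ltr_wpDr //.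
by move=> /le_lt_trans/(_ (Hdl _ hg)); rewrite ltxx.
Qed.

End Homotopy.

(** * Stability *)

Section Stability.

Variables (R : realType) (V : vectType R) (n : nat) (p : vpoly V) (e : V).
Hypothesis hyp : hyperbolic_system n p e.

Let hp := hs_homogeneous hyp.
Let pe0 := hs_eval_neq0 hyp.

Local Notation C := (R[i]).
Local Notation Im := (@complex.Im R).
Local Notation RC := (real_complex R).
Local Notation cv x := (fun i => RC (vcoord x i)).

Lemma map_charp (q : vpoly V) (x : V) (z : C) :
  (map_poly RC (charp q e x)).[z] =
  mmap RC (fun i => z * RC (vcoord e i) - RC (vcoord x i)) q.
Proof.
rewrite charp_line map_line horner_line; apply: mmap_eq => // i /=.
by rewrite rmorphN addrC mulrC.
Qed.

(** The value is that of the characteristic polynomial of [- w] at [z], and this polynomial has only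
    real zeros. *)
Lemma mmap_nonreal (w : V) (z : C) : Im z != 0 ->
  mmap RC (fun i => z * RC (vcoord e i) + RC (vcoord w i)) p != 0.
Proof.
move=> z0; have -> : mmap RC (fun i => z * RC (vcoord e i) + RC (vcoord w i)) p
    = (map_poly RC (charp p e (- w))).[z].
  rewrite map_charp; apply: mmap_eq => // i.
  by rewrite /vcoord linearN rmorphN opprK.
apply: contraNneq z0 => /rootP/(@hs_real_zeros _ _ _ _ _ hyp)[t ->].
by rewrite eqxx.
Qed.

Lemma mmap_real (x : V) : mmap RC (cv x) p = RC (veval p x).
Proof. by rewrite /veval /meval rmorph_mmap. Qed.

Section OpenCone.

Variables (b : V) (s : seq R).
Hypothesis Eb : charp p e b = veval p e *: \prod_(a <- s) ('X - a%:P).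
Hypothesis b0 : forall a, a \in s -> 0 < a.

(** The characteristic polynomial of [b] takes at 0 the value [p(-b)], which is [p(b)] up to sign,
    and 0 is not an eigenvalue. *)
Lemma veval_cone_neq0 : veval p b != 0.
Proof.
have : (charp p e b).[0] != 0.
  rewrite Eb -rootE rootZ // root_prod_XsubC; apply/negP => /b0.
  by rewrite ltxx.
rewrite charp_horner scale0r add0r; apply: contraNneq => pb.
rewrite /veval /meval (@mmap_eq _ _ _ _ idfun _ (fun i => -1 * vcoord b i)) //.
  by rewrite (mmap_dhomog _ _ _ hp) -/(meval _ _) -/(veval p b) pb mulr0.
by move=> i; rewrite mulN1r /vcoord linearN.
Qed.

(** The base point is deformed from [i (Im z) e] to [z e - x]. At the start the roots are
    [- i (Im z) / a] with [a] an eigenvalue of [b], hence below the axis. *)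
Lemma stable_line (x : V) (z r : C) : 0 < Im z ->
  root (line RC (fun i => z * RC (vcoord e i) - RC (vcoord x i)) (cv b) p) r ->
  Im r < 0.
Proof.
move=> z0; pose eta : C := RC (Im z) * 'i%C; pose w := complex.Re z *: e - x.
have Ime : Im eta != 0 by rewrite /= !mul0r !mulr1 addr0 gt_eqF.
pose v g i := eta * RC (vcoord e i) + RC g * RC (vcoord w i).
(* Gårding's homotopy: a real root of [S g] would be a nonreal eigenvalue. *)
pose S g := line RC (v g) (cv b) p.
have -> : line RC (fun i => z * RC (vcoord e i) - RC (vcoord x i)) (cv b) p = S 1.
  apply: mmap_eq => // i; congr (_%:P + _); rewrite /v rmorph1 mul1r.
  rewrite /w /vcoord linearB linearZ /= rmorphB rmorphM /=.
  rewrite addrA -mulrDl {1}(complexE z) /eta; congr (_ * _ - _).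
  by rewrite addrC mulrC.
apply: (@homotopy_lower_half _ n (RC (veval p b)) S).
- by rewrite fmorph_eq0 veval_cone_neq0.
- by move=> g; apply: size_line hp _ _.
- by move=> g; rewrite (coef_line_lead _ hp) mmap_real.
(* The homotopy parameter becomes an indeterminate of the coefficient ring; evaluating the
   coefficients of [B] at [g] gives those of [S g]. *)
- move=> k; pose B := line (polyC \o RC)
    (fun i => (eta * RC (vcoord e i))%:P + (RC (vcoord w i))%:P * 'X)
    (fun i => (RC (vcoord b i))%:P) p.
  exists B`_k => g; rewrite -/(horner_eval (RC g) B`_k) -coef_map map_line.
  apply: (congr1 (fun q : {poly C} => q`_k)).
  apply: mmap_eq => i /=; last congr (_%:P + _%:P * _).
  - by rewrite /horner_eval hornerC.
  - by rewrite /horner_eval !hornerE /v; congr (_ + _); rewrite mulrC.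
  - by rewrite /horner_eval hornerC.
- move=> g y _; rewrite rootE horner_line.
  have := mmap_nonreal (g *: w + y *: b) Ime.
  congr (_ != 0); apply: mmap_eq => // i.
  rewrite /v /vcoord linearD !linearZ /= rmorphD !rmorphM /= -addrA.
  by congr (_ + (_ + _)); rewrite mulrC.
move=> q /rootP; rewrite horner_line => Sq.
have q0 : q != 0.
  apply: contraTneq isT => q0; have /eqP[] := mmap_nonreal 0 Ime.
  apply: etrans Sq; apply: mmap_eq => // i.
  by rewrite q0 /v mulr0 !rmorph0 mul0r /vcoord linear0 rmorph0 !addr0.
(* By homogeneity [p(eta e + q b) = (-q)^n p(-(eta / q) e - b)], so [- eta / q] is an eigenvalue of
   [b]. *)
have : root (map_poly RC (charp p e b)) (- eta / q).
  have nq : (- q) ^+ n != 0 by rewrite expf_neq0 ?oppr_eq0.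
  apply/rootP; rewrite map_charp; apply: (mulfI nq).
  rewrite -(mmap_dhomog _ _ _ hp) mulr0; apply: etrans Sq; apply: mmap_eq => // i.
  by rewrite /v rmorph0 mul0r addr0; field.
rewrite Eb map_polyZ rmorph_prod /= rootZ ?fmorph_eq0 //.
under eq_bigr do rewrite map_polyXsubC.
rewrite -(big_map RC xpredT (fun a => 'X - a%:P)) root_prod_XsubC.
case/mapP => a /b0 a0 Ea; have Eq : q = RC (- Im z / a) * 'i%C.
  have a0' : RC a != 0 by rewrite fmorph_eq0 gt_eqF.
  apply: (mulfI a0'); rewrite -{1}Ea divfK // [RHS]mulrA -rmorphM /=.
  by rewrite mulrCA divff ?gt_eqF // mulr1 rmorphN mulNr.
by rewrite Eq /= mulr1 mul0r addr0 mulNr oppr_lt0 divr_gt0.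
Qed.
End OpenCone.

(* The polynomial [t |-> d/ds p (t e - x + s b)] at [s = 0]. *)
Definition dcharp (b x : V) : {poly R} :=
  \sum_i vcoord b i *: charp (p^`M(i)) e x.

Lemma dcharpD (b c x : V) (t : R) :
  dcharp (b + t *: c) x = dcharp b x + t *: dcharp c x.
Proof.
rewrite /dcharp scaler_sumr -big_split; apply: eq_bigr => i _.
by rewrite /vcoord linearD linearZ /= scalerDl scalerA.
Qed.

Lemma coef1_line (b x : V) (z : C) :
  (line RC (fun i => z * RC (vcoord e i) - RC (vcoord x i)) (cv b) p)`_1 =
  (map_poly RC (dcharp b x)).[z].
Proof.
set L := line _ _ _ _; have -> : L`_1 = (L^`())`_0 by rewrite coef_deriv mulr1n.
rewrite deriv_line coef_sum /dcharp raddf_sum /= horner_sum; apply: eq_bigr => i _.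
rewrite coefZ map_polyZ hornerZ map_charp -horner_coef0 horner_line.
by congr (_ * _); apply: mmap_eq => // j; rewrite mulr0 addr0.
Qed.

(** For nonzero [c] this is, up to the factor [|Q(0)|^2], the imaginary part of
    [Q'(0) / Q(0) = - sum 1 / r], and [Im (- 1 / r)] has the sign of [Im r]. *)
Lemma Im_logderiv_lower_half (c : C) (rs : seq C) (Q : {poly C}) :
  Q = c *: \prod_(r <- rs) ('X - r%:P) ->
  (forall r, r \in rs -> Im r < 0) -> Im (Q`_1 * (Q`_0)^*%C) <= 0.
Proof.
elim: rs Q => [Q ->|r rs IH Q EQ Him].
  by rewrite big_nil alg_polyC !coefC /= mul0r.
pose Q2 := c *: \prod_(r <- rs) ('X - r%:P).
have {}EQ : Q = Q2 * 'X - r *: Q2.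
  by rewrite EQ big_cons scalerAr -/Q2 mulrBl mulrC mul_polyC.
have Q0 : Q`_0 = - (r * Q2`_0) by rewrite EQ coefB coefMX (coefZ r Q2) /= sub0r.
have Q1 : Q`_1 = Q2`_0 - r * Q2`_1 by rewrite EQ coefB coefMX (coefZ r Q2).
have /(IH Q2 erefl) : forall r, r \in rs -> Im r < 0.
  by move=> x xrs; apply: Him; rewrite inE xrs orbT.
have := Him r (mem_head _ _); rewrite Q0 Q1.
case: r {Him EQ Q0 Q1} => a b; case: (Q2`_0) => u v; case: (Q2`_1) => k l /=.
move=> b0 H.
rewrite [leLHS](_ : _ = b * (u ^+ 2 + v ^+ 2) +
    (a ^+ 2 + b ^+ 2) * (k * - v + l * u)); last by ring.
rewrite -[leRHS]addr0 lerD //.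
  by rewrite mulr_le0_ge0 ?(ltW b0) // addr_ge0 ?sqr_ge0.
by rewrite mulr_ge0_le0 // addr_ge0 ?sqr_ge0.
Qed.

Lemma Im_dcharp_open (b x : V) (s : seq R) (z : C) :
  charp p e b = veval p e *: \prod_(a <- s) ('X - a%:P) ->
  (forall a, a \in s -> 0 < a) -> 0 < Im z ->
  Im ((map_poly RC (dcharp b x)).[z] * ((map_poly RC (charp p e x)).[z])^*%C)
    <= 0.
Proof.
move=> Eb b0 z0; rewrite -coef1_line.
set L := line _ _ _ _; have -> : (map_poly RC (charp p e x)).[z] = L`_0.
  rewrite map_charp -horner_coef0 horner_line.
  by apply: mmap_eq => // i; rewrite mulr0 addr0.
have [rs EL] := closed_field_poly_normal L.
have L0 : L != 0.
  have := veval_cone_neq0 Eb b0; apply: contraNneq => L0.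
  rewrite -(fmorph_eq0 RC) /= -mmap_real.
  rewrite -(coef_line_lead _ hp (fun i => z * RC (vcoord e i) - RC (vcoord x i))).
  by rewrite -/L L0 coef0.
apply: (Im_logderiv_lower_half EL) => r rrs.
suff rL : root L r by apply: stable_line Eb b0 x z r z0 rL.
by rewrite EL rootZ ?lead_coef_eq0 // root_prod_XsubC.
Qed.

(** The eigenvalues of [b + dl e] are positive for [dl > 0], so the open case applies; the
    inequality is affine in [dl] and survives the limit. *)
Lemma Im_dcharp (b x : V) (z : C) : hyp_cone n p e b -> 0 < Im z ->
  Im ((map_poly RC (dcharp b x)).[z] * ((map_poly RC (charp p e x)).[z])^*%C)
    <= 0.
Proof.
move=> cb z0; set f := (_.[z])^*%C.
have [s [sz _ Es Eeig]] := eigenvaluesP hyp b.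
have s0 a : a \in s -> 0 <= a.
  case/(nthP 0) => i; rewrite sz => ni <-.
  by rewrite -(Eeig (Ordinal ni)).
pose T := Im ((map_poly RC (dcharp e x)).[z] * f).
have key dl : 0 < dl ->
    Im ((map_poly RC (dcharp b x)).[z] * f) + dl * T <= 0.
  move=> dl0; have := @Im_dcharp_open (b + dl *: e) x _ z
    (charp_shift dl Es) _ z0.
  rewrite dcharpD rmorphD /= map_polyZ hornerD hornerZ mulrDl raddfD /=.
  rewrite -/f /T -mulrA => H.
  have ImZ (w : C) : Im (RC dl * w) = dl * Im w.
    by case: w => ? ? /=; rewrite mul0r addr0.
  rewrite -ImZ; apply: H => a /mapP[a' /s0 a'0 ->]; rewrite ltr_wpDl //.
rewrite leNgt; apply/negP; set A := Im _ in key * => A0.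
have T1 : 0 < `|T| + 1 by rewrite ltr_wpDl.
(* This [dl] keeps [dl |T|] below [A / 2], so [A + dl T] stays positive; the [+ 1] covers
   [T = 0]. *)
have := key (A / (2 * (`|T| + 1))) (divr_gt0 A0 (mulr_gt0 (ltr0Sn R 1) T1)).
apply/negP; rewrite -ltNge.
have : - (A / 2) <= A / (2 * (`|T| + 1)) * T.
  rewrite invfM mulrA -mulrA -[leLHS]mulrN1 ler_wpM2l ?divr_ge0 ?ltW //.
  rewrite mulrC ltr_pdivlMr // mulN1r ltrNl.
  by rewrite (le_lt_trans (ler_norm _)) // normrN ltrDl.
by lra.
Qed.

End Stability.

(** * Partial fractions with nonnegative residues *)

Section Residues.

Variable R : realType.
Local Notation C := (R[i]).
Local Notation Im := (@complex.Im R).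
Local Notation RC := (real_complex R).
Implicit Types (h f : {poly R}) (s : seq R).

Local Notation prodX s := (\prod_(a <- s) ('X - a%:P)).

(* [Im (h / f) <= 0] on the upper half-plane, without the denominator. *)
Definition im_quot_le0 (h f : {poly R}) := forall z : C, 0 < Im z ->
  Im ((map_poly RC h).[z] * ((map_poly RC f).[z])^*%C) <= 0.

Lemma conj_map_poly f (z : C) :
  ((map_poly RC f).[z])^*%C = (map_poly RC f).[z^*%C].
Proof.
rewrite !horner_coef rmorph_sum /=; apply: eq_bigr => i _.
by rewrite rmorphM rmorphXn /= coef_map; congr (_ * _); exact: conjc_real.
Qed.

Lemma Im_horner_at0 (A : {poly C}) :
  (forall rho : R, 0 < rho -> Im A.[RC rho] <= 0) -> Im A.[0] <= 0.
Proof.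
move=> HA; rewrite leNgt; apply/negP => A0.
have [M M0 HM] := poly_local_lipschitz A 0.
have A0' : 0 < RC (Im A.[0]) by rewrite ltcR.
have [dl /andP[dl0 dl1] Hdl] := real_complex_small A0' M0.
have rho0 : 0 < dl / 2 by lra.
have absrho : `|dl / 2| < dl by rewrite gtr0_norm //; lra.
have nrho : `|RC (dl / 2) - 0| <= 1.
  rewrite subr0 normc_def /= expr0n addr0 sqrtr_sqr lecR.
  by rewrite (le_trans (ltW absrho)).
have := HM _ nrho; rewrite subr0 => /le_lt_trans/(_ (Hdl _ absrho)).
have := normc_ge_Im (A.[RC (dl / 2)] - A.[0]) => /le_lt_trans H /H.
rewrite ltcR raddfB /=; have := HA _ rho0 => H1.
have := ler_norm (- (Im A.[RC (dl / 2)] - Im A.[0])); rewrite normrN; lra.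
Qed.

(** Along [z = mu + rho w] the pole contributes the factor [(rho conj w)^q]. Dividing by [rho^q] and
    letting [rho] decrease to 0 leaves the values at [mu]. *)
Lemma im_quot_local (h f : {poly R}) (mu : R) (q : nat) (w : C) :
  im_quot_le0 h (('X - mu%:P) ^+ q * f) -> 0 < Im w ->
  h.[mu] * f.[mu] * Im (w^*%C ^+ q) <= 0.
Proof.
move=> H w0.
(* Conjugation is moved onto the argument, [conj f(z) = f(conj z)], so that the divided expression
   is a polynomial in [rho]. *)
pose A : {poly C} := (map_poly RC h \Po ((RC mu)%:P + w *: 'X)) *
  (w^*%C ^+ q *: (map_poly RC f \Po ((RC mu)%:P + w^*%C *: 'X))).
have := @Im_horner_at0 A; rewrite /A !hornerM !hornerZ !horner_comp !hornerE.
rewrite !horner_map /=.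
have -> : Im (RC h.[mu] * w^*%C ^+ q * RC f.[mu]) =
          h.[mu] * f.[mu] * Im (w^*%C ^+ q).
  by case: (w^*%C ^+ q) => a b /=; ring.
apply=> rho rho0; rewrite !hornerE !horner_comp !hornerE.
have := H (RC mu + w * RC rho).
have -> : Im (RC mu + w * RC rho) = rho * Im w.
  by case: (w) => a b /=; ring.
move=> /(_ (mulr_gt0 rho0 w0)).
rewrite conj_map_poly rmorphM rmorphXn /= map_polyXsubC hornerM horner_exp.
rewrite hornerXsubC.
have -> : (RC mu + w * RC rho)^*%C = RC mu + w^*%C * RC rho.
  by rewrite rmorphD rmorphM; congr (_ + _ * _); exact: conjc_real.
set x := (_.[_ + w * _]); set y := (_.[_ + w^*%C * _]).
rewrite addrAC subrr add0r exprMn => Hx.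
rewrite -(ler_pM2l (exprn_gt0 q rho0)) mulr0; apply: le_trans Hx.
rewrite le_eqVlt; apply/orP; left; apply/eqP.
have ImZ (c : R) (v : C) : c * Im v = Im (RC c * v).
  by case: v => ? ? /=; rewrite mul0r addr0.
by rewrite ImZ rmorphXn /=; congr (Im _); move: (_ ^+ q) (_ ^+ q) => u v; ring.
Qed.

(* False for [q = 1]: this is what excludes multiple poles. *)
Lemma exists_root_upper (q : nat) (c : C) : (1 < q)%N -> Im c != 0 ->
  exists2 w : C, 0 < Im w & w ^+ q = c.
Proof.
move=> q1 c0; have q0 : (0 < q)%N by apply: ltnW.
exists (q.-root c); last by rewrite rootCK.
(* For [q > 1] the principal root has nonnegative imaginary part; if that part were zero, [c] would
   be real. *)
rewrite lt_neqAle -ler0c complexIm Im_rootC_ge0 // andbT.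
apply: contraNneq c0 => w0.
suff -> : c = RC (complex.Re (q.-root c) ^+ q) by [].
rewrite rmorphXn /= -{1}(rootCK q0 c); congr (_ ^+ _).
by apply/eqP; rewrite eq_complex /= -w0 !eqxx.
Qed.

Lemma im_quot_simple (h f : {poly R}) (mu : R) :
  im_quot_le0 h (('X - mu%:P) * f) -> 0 <= h.[mu] * f.[mu].
Proof.
rewrite -['X - _]expr1 => H.
have := @im_quot_local h f mu 1 'i%C H ltr01.
by rewrite expr1 /= mulrN1 oppr_le0.
Qed.

(** Both [i] and [- i] are [q]-th powers of points of the upper half-plane, so the local inequality
    holds with both signs. *)
Lemma im_quot_multiple (h f : {poly R}) (mu : R) (q : nat) : (1 < q)%N ->
  im_quot_le0 h (('X - mu%:P) ^+ q * f) -> h.[mu] * f.[mu] = 0.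
Proof.
move=> q1 Hq; have H w := @im_quot_local h f mu q w Hq.
have [|w w0 Ew] := @exists_root_upper q 'i%C q1; first exact: oner_neq0.
have [|v v0 Ev] := @exists_root_upper q (- 'i%C) q1.
  by rewrite /= oppr_eq0 oner_neq0.
have := H _ w0; have := H _ v0; rewrite -!rmorphXn /= Ew Ev /=.
rewrite opprK mulr1 mulrN1 oppr_le0 => h1 h2; apply/le_anti.
by rewrite h1 h2.
Qed.

(** [x \in rem x s] says that [x] occurs at least twice; each step drops one repetition, just as one
    factor of a multiple pole is cancelled. *)
Lemma seq_dup_ind (T : eqType) (P : seq T -> Prop) :
  (forall s : seq T, uniq s -> P s) ->
  (forall (s : seq T) x, x \in rem x s -> P (rem x s) -> P s) ->
  forall s : seq T, P s.
Proof.
move=> Pu Pd s; have [m] := ubnP (size s); elim: m s => // m IH s.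
rewrite ltnS => szs; have [/Pu//|] := boolP (uniq s).
have [/hasP[x xs xx] _|/hasPn nh /negP[]] := boolP (has (fun x => x \in rem x s) s).
  apply: (Pd s x) => //; apply: IH.
  by rewrite size_rem // -ltnS prednK //; case: (s) xs.
elim: s nh {szs} => //= x s IHs nh.
have := nh x (mem_head _ _); rewrite eqxx => -> /=; apply: IHs => y ys.
have := nh y; rewrite inE ys orbT => /(_ isT); case: eqVneq => [<-|xy].
  by apply: contraNN => /mem_rem.
by rewrite inE negb_or => /andP[].
Qed.

Lemma prodX_rem s (a : R) : a \in s ->
  prodX s = ('X - a%:P) * prodX (rem a s).
Proof. by move=> as_; rewrite (perm_big _ (perm_to_rem as_)) big_cons. Qed.

Lemma prodX_rem_rem s (a b : R) : b \in s -> a \in rem b s ->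
  prodX (rem a s) = ('X - b%:P) * prodX (rem a (rem b s)).
Proof.
move=> bs abs; rewrite -(big_cons _ _ b _ xpredT (fun a => 'X - a%:P)).
apply: perm_big; rewrite -(perm_cons a).
have as_ : a \in s by apply: mem_rem abs.
rewrite -(permPl (perm_to_rem as_)) (permPl (perm_to_rem bs)).
rewrite perm_sym (perm_catCA [:: a] [:: b]) /= perm_cons perm_sym.
exact: perm_to_rem.
Qed.

Lemma perm_undup_rem s (b : R) : b \in rem b s ->
  perm_eq (undup s) (undup (rem b s)).
Proof.
move=> bs; have bs' := mem_rem bs.
apply: uniq_perm; rewrite ?undup_uniq // => a; rewrite !mem_undup.
rewrite (perm_mem (perm_to_rem bs')) inE.
by case: eqVneq => // ->; rewrite bs.
Qed.

(** Dropping one copy of a repeated root keeps the set of distinct roots, and the factor of that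
    copy is common to all terms. This drives the induction for both uniqueness and existence of
    residues. *)
Lemma sum_prodX_rem (w : R -> R) s (b : R) : b \in rem b s ->
  \sum_(a <- undup s) w a *: prodX (rem a s) =
  ('X - b%:P) * \sum_(a <- undup (rem b s)) w a *: prodX (rem a (rem b s)).
Proof.
move=> bs; rewrite (perm_big _ (perm_undup_rem bs)) /= mulr_sumr.
rewrite big_seq [RHS]big_seq; apply: eq_bigr => a; rewrite mem_undup => abs.
by rewrite (prodX_rem_rem (mem_rem bs) abs) scalerAr.
Qed.

Lemma horner_sum_prodX_uniq (w : R -> R) s (b : R) : uniq s -> b \in s ->
  (\sum_(a <- undup s) w a *: prodX (rem a s)).[b] = w b * (prodX (rem b s)).[b].
Proof.
move=> us bs; rewrite undup_id // horner_sum (bigD1_seq b) //= hornerZ.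
rewrite [X in _ + X]big1_seq ?addr0 // => a /andP[ab as_].
rewrite hornerZ; suff /rootP -> : root (prodX (rem a s)) b by rewrite mulr0.
by rewrite root_prod_XsubC mem_rem_uniq // inE eq_sym ab.
Qed.

Lemma horner_prodX_rem_neq0 s (b : R) : uniq s -> (prodX (rem b s)).[b] != 0.
Proof.
by move=> us; rewrite -rootE root_prod_XsubC mem_rem_uniq // inE eqxx.
Qed.

Lemma residues_unique (w : R -> R) s :
  \sum_(a <- undup s) w a *: prodX (rem a s) = 0 ->
  forall a, a \in s -> w a = 0.
Proof.
elim/seq_dup_ind: s => [s us E a as_|s b bs IH].
  have := horner_sum_prodX_uniq w us as_; rewrite E horner0 => /esym/eqP.
  by rewrite mulf_eq0 (negbTE (horner_prodX_rem_neq0 _ us)) orbF => /eqP.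
rewrite (sum_prodX_rem w bs) => /eqP; rewrite mulf_eq0 polyXsubC_eq0 /=.
move=> /eqP/IH H a; rewrite (perm_mem (perm_to_rem (mem_rem bs))) inE.
by case: eqVneq => [-> _|_] /=; apply: H.
Qed.

(** Divided by the product over [s], the sum is that of the [w a / ('X - a)]. For distinct roots
    this is Lagrange interpolation; a repeated root must be a root of [h], and one factor
    cancels. *)
Lemma residues_exist h s : (size h <= size s)%N -> im_quot_le0 h (prodX s) ->
  exists2 w : R -> R, forall a, a \in s -> 0 <= w a &
    h = \sum_(a <- undup s) w a *: prodX (rem a s).
Proof.
elim/seq_dup_ind: s h => [s us h szh H|s b bs IH h szh H].
  (* The denominator is the derivative of the full product at [a], so this is the residue of the
     quotient. *)
  pose w a := h.[a] / (prodX (rem a s)).[a].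
  exists w => [a as_|].
    move: H; rewrite (prodX_rem as_) => /im_quot_simple hd.
    have d0 := horner_prodX_rem_neq0 a us.
    have -> : w a =
        h.[a] * (prodX (rem a s)).[a] / (prodX (rem a s)).[a] ^+ 2.
      by rewrite /w; field.
    by rewrite divr_ge0 ?sqr_ge0.
  (* The difference has size at most [size s] and vanishes at the [size s] distinct elements of
     [s]. *)
  apply/eqP; rewrite -subr_eq0; apply/eqP.
  apply: (@roots_geq_poly_eq0 _ _ s) => //.
    apply/allP => a as_; rewrite rootE hornerD hornerN.
    rewrite (horner_sum_prodX_uniq w us as_) /w divfK ?subrr //.
    exact: horner_prodX_rem_neq0.
  rewrite (leq_trans (size_polyD _ _)) // geq_max szh size_polyN /=.
  rewrite undup_id // big_seq.
  apply: (big_ind (fun q : {poly R} => size q <= size s)%N).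
  - by rewrite size_poly0.
  - by move=> q1 q2 s1 s2; rewrite (leq_trans (size_polyD _ _)) // geq_max s1.
  - move=> a as_; rewrite (leq_trans (size_scale_leq _ _)) // size_prod_XsubC.
    by rewrite size_rem // prednK //; case: (s) as_.
have bs' := mem_rem bs.
have hb : root h b.
  move: H; pose q := count_mem b s; pose f := prodX (filter (predC (pred1 b)) s).
  have -> : prodX s = ('X - b%:P) ^+ q * f.
    rewrite /f /q; elim: (s) => [|c t IHt]; first by rewrite !big_nil mulr1.
    rewrite big_cons IHt /=; case: eqVneq => [->|_] /=.
      by rewrite add1n exprS mulrA.
    by rewrite big_cons add0n mulrCA.
  have q1 : (1 < q)%N.
    have := perm_to_rem bs' => /permP/(_ (pred1 b)); rewrite -/q /= eqxx => ->.
    by rewrite add1n ltnS -has_count has_pred1.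
  move=> /(im_quot_multiple q1)/eqP; rewrite mulf_eq0 => /orP[//|].
  by rewrite -rootE root_prod_XsubC mem_filter /= eqxx.
have /factor_theorem[h2 Eh] := hb.
have [||w w0 Ew] := IH h2.
- have [->|h20] := eqVneq h2 0; first by rewrite size_poly0.
  move: szh; rewrite Eh size_Mmonic ?monicXsubC // size_XsubC addn2 /=.
  by rewrite size_rem //; case: (size s).
- move=> z z0; have := H z z0; rewrite Eh (prodX_rem bs') !rmorphM /=.
  rewrite map_polyXsubC !hornerM hornerXsubC.
  set u := _.[z]; set v := (map_poly RC (prodX _)).[z].
  (* The cancelled factor contributes [|z - b|^2], which is positive on the upper half-plane. *)
  rewrite [X in Im X](_ : _ = (z - RC b) * (z - RC b)^*%C * (u * v^*%C)); last first.
    by rewrite rmorphM /=; ring.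
  have zb : 0 < (complex.Re z - b) ^+ 2 + Im z ^+ 2.
    by rewrite ltr_wpDl ?sqr_ge0 ?exprn_gt0.
  have -> : Im ((z - RC b) * (z - RC b)^*%C * (u * v^*%C)) =
      ((complex.Re z - b) ^+ 2 + Im z ^+ 2) * Im (u * v^*%C).
    by case: (u * v^*%C) => u1 u2; case: (z) => x y /=; ring.
  by rewrite pmulr_rle0.
exists w => [a|]; last by rewrite (sum_prodX_rem w bs) -Ew mulrC.
rewrite (perm_mem (perm_to_rem bs')) inE.
by case: eqVneq => [-> _|_] /=; apply: w0.
Qed.

End Residues.

(** * Directional derivatives *)

Section Directional.

Variables (R : realType) (V : vectType R) (n : nat) (p : vpoly V) (e : V).
Hypothesis hyp : hyperbolic_system n.+1 p e.

Let hp := hs_homogeneous hyp.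
Let pe0 := hs_eval_neq0 hyp.

Local Notation prodX s := (\prod_(a <- s) ('X - a%:P)).

Lemma dcharp_sum (I : finType) (c : I -> R) (b : I -> V) (x : V) :
  dcharp p e (\sum_i c i *: b i) x = \sum_i c i *: dcharp p e (b i) x.
Proof.
rewrite /dcharp; under [RHS]eq_bigr do rewrite scaler_sumr.
rewrite exchange_big; apply: eq_bigr => j _.
rewrite /vcoord (linear_sum (coord (vbasis fullv) j)) /= scaler_suml.
by apply: eq_bigr => i _; rewrite linearZ scalerA.
Qed.

Lemma size_dcharp (b x : V) : (size (dcharp p e b x) <= n.+1)%N.
Proof.
apply: (big_ind (fun q : {poly R} => size q <= n.+1)%N).
- by rewrite size_poly0.
- by move=> q1 q2 s1 s2; rewrite (leq_trans (size_polyD _ _)) // geq_max s1.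
- move=> i _; rewrite (leq_trans (size_scale_leq _ _)) // charp_line.
  exact: size_line (dhomog_mderiv i hp) _ _.
Qed.

(** Both sides are the derivative of [p] at [e] along [b], the right one by Vieta and the reversal
    of [t |-> p(t e - b)]. *)
Lemma coef_dcharp_lead (b x : V) :
  (dcharp p e b x)`_n = veval p e * hyp_trace n.+1 p e b.
Proof.
have [s [sz _ Es Eeig]] := eigenvaluesP hyp b.
have -> : hyp_trace n.+1 p e b = \sum_(a <- s) a.
  by rewrite (big_nth 0) sz big_mkord; apply: eq_bigr => i _; apply: Eeig.
have Eb : (charp p e b)`_n = - (veval p e * \sum_(a <- s) a).
  by rewrite Es coefZ -[n]/(n.+1.-1) -sz coefPn_prod_XsubC ?sz // mulrN.
rewrite -[RHS]opprK -Eb charp_line.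
have -> : n = (n.+1 - 1)%N by rewrite subn1.
rewrite [in RHS](coef_line _ hp) // subn1 /=.
set L := line _ _ _ _; have -> : L`_1 = (L^`())`_0 by rewrite coef_deriv mulr1n.
rewrite deriv_line !coef_sum -sumrN; apply: eq_bigr => i _.
rewrite !coefZ mulNr opprK; congr (_ * _).
rewrite charp_line (coef_line_lead _ (dhomog_mderiv i hp)) -horner_coef0.
by rewrite horner_line; apply: mmap_eq => // k; rewrite mulr0 addr0.
Qed.

Lemma dcharp_dir (x : V) : dcharp p e e x = (charp p e x)^`().
Proof.
rewrite charp_line deriv_line; apply: eq_bigr => i _.
by rewrite -charp_line.
Qed.

(** Differentiate [p(u y) = u^(n+1) p(y)] at [u = 1]. *)
Lemma euler_identity (y : V) :
  \sum_i vcoord y i * veval (p^`M(i)) y = n.+1%:R * veval p y.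
Proof.
have EL : line idfun (fun=> 0) (vcoord y) p = veval p y *: 'X^(n.+1).
  apply: poly_ext_neq0 => u _; rewrite horner_line hornerZ hornerXn mulrC.
  rewrite -(mmap_dhomog _ _ _ hp); apply: mmap_eq => // i.
  by rewrite add0r mulrC.
have := congr1 (fun q : {poly R} => q^`().[1]) EL.
rewrite /= deriv_line derivZ derivXn !hornerE hornerMn hornerXn expr1n.
rewrite horner_sum mulrC => <-; apply: eq_bigr => i _.
rewrite hornerZ horner_line; congr (_ * _); apply: mmap_eq => // j.
by rewrite add0r mulr1.
Qed.

(** Write the direction as [x = t e - (t e - x)] and apply Euler's identity at [t e - x]. *)
Lemma dcharp_self (x : V) :
  dcharp p e x x = 'X * (charp p e x)^`() - n.+1%:R *: charp p e x.
Proof.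
rewrite -dcharp_dir; apply: poly_ext_neq0 => t _.
rewrite hornerD hornerN hornerM hornerX hornerZ charp_horner -euler_identity.
rewrite !horner_sum mulr_sumr -sumrB; apply: eq_bigr => i _.
rewrite !hornerZ charp_horner /vcoord linearB linearZ /=; ring.
Qed.

End Directional.

(** * Sums over the roots of a split polynomial *)

Section RootSums.

Variable R : realType.
Implicit Types s : seq R.
Local Notation prodX s := (\prod_(a <- s) ('X - a%:P)).

Lemma deriv_prodX s : (prodX s)^`() = \sum_(a <- s) prodX (rem a s).
Proof.
elim: s => [|b s IH]; first by rewrite !big_nil derivC.
rewrite !big_cons /= eqxx derivM derivXsubC mul1r IH mulr_sumr; congr (_ + _).
rewrite big_seq [RHS]big_seq; apply: eq_bigr => a as_.
by case: eqVneq => [->|_]; rewrite ?big_cons // -prodX_rem.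
Qed.

Lemma sum_undup_count (W : zmodType) (F : R -> W) s :
  \sum_(a <- s) F a = \sum_(a <- undup s) F a *+ count_mem a s.
Proof.
rewrite -big_undup_iterop_count; apply: eq_bigr => a _.
by rewrite Monoid.iteropE iter_addr_0.
Qed.

(** Termwise this is ['X / ('X - a) - 1 = a / ('X - a)]. *)
Lemma euler_prodX s : 'X * (prodX s)^`() - (size s)%:R *: prodX s =
  \sum_(a <- s) a *: prodX (rem a s).
Proof.
rewrite deriv_prodX mulr_sumr.
have -> : (size s)%:R *: prodX s = \sum_(a <- s) prodX s.
  by rewrite big_const_seq count_predT scaler_nat iter_addr_0.
rewrite -sumrB big_seq [RHS]big_seq; apply: eq_bigr => a as_.
by rewrite (prodX_rem as_) -mulrBl opprB addrC subrK mul_polyC.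
Qed.

Lemma coef_prodX_rem s (a : R) (n : nat) : a \in s -> size s = n.+1 ->
  (prodX (rem a s))`_n = 1.
Proof.
move=> as_ sz; have /monicP := monic_prod_XsubC (rem a s) xpredT id.
by rewrite lead_coefE size_prod_XsubC size_rem // sz.
Qed.

End RootSums.

(** * Majorization from double stochasticity, and the equivalence *)

Lemma doubly_stochastic_majorized (R : realType) (V : vectType R) (n : nat)
    (p : vpoly V) (e : V) (hyp : hyperbolic_system n p e) (A : n.-tuple V)
    (r : 'cV[R]_n) : doubly_stochastic p e A ->
  majorized (eigenvalues n p e (Vmatrix_mul A r)) r.
Proof.
case: n p hyp A r => [|n] p hyp A r [dsA sumA].
  (* In degree 0 the empty sum would equal [e], which is nonzero. *)
  by move: (hs_direction_neq0 hyp); rewrite -sumA big_ord0 eqxx.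
set x := Vmatrix_mul A r; set c := veval p e.
have c0 : c != 0 := hs_eval_neq0 hyp.
have [s [sz _ Es Eeig]] := eigenvaluesP hyp x.
pose F := \prod_(a <- s) ('X - a%:P).
pose P a := \prod_(b <- rem a s) ('X - b%:P).
pose h b := c^-1 *: dcharp p e b x.
have hsum (k : 'I_n.+1 -> R) :
    h (\sum_i k i *: tnth A i) = \sum_i k i *: h (tnth A i).
  rewrite /h dcharp_sum scaler_sumr; apply: eq_bigr => i _.
  by rewrite !scalerA mulrC.
have hw i : exists2 w : R -> R, forall a, a \in s -> 0 <= w a &
    h (tnth A i) = \sum_(a <- undup s) w a *: P a.
  apply: residues_exist.
    by rewrite sz (leq_trans (size_scale_leq _ _)) // (size_dcharp hyp).
  move=> z z0; have := Im_dcharp hyp x (proj1 (dsA i)) z0.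
  rewrite Es !map_polyZ !hornerZ -/F.
  set D := _.[z]; set G := _.[z] => H.
  (* The sign of [c] is unknown, but the normalization only introduces the positive factor
     [1 / c^2]. *)
  have -> : complex.Im (real_complex R c^-1 * D * G^*%C) =
      (c ^+ 2)^-1 * complex.Im (D * (real_complex R c * G)^*%C).
    by case: (D) => u v; case: (G) => u' v' /=; field.
  by rewrite mulr_ge0_le0 // invr_ge0 sqr_ge0.
have [w w0 Ew] := fin_all_exists2 hw.
have he : h e = \sum_(a <- undup s) (count_mem a s)%:R *: P a.
  rewrite /h dcharp_dir Es derivZ scalerA mulVf // scale1r deriv_prodX.
  by rewrite sum_undup_count; apply: eq_bigr => a _; rewrite scaler_nat.
have hx : h x = \sum_(a <- undup s) ((count_mem a s)%:R * a) *: P a.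
  rewrite /h (dcharp_self hyp) Es derivZ -scalerAr -/c.
  rewrite [_ *: (c *: _)]scalerA [_ * c]mulrC -scalerA -scalerBr scalerA.
  rewrite mulVf // scale1r -sz euler_prodX.
  rewrite sum_undup_count; apply: eq_bigr => a _.
  by rewrite -scaler_nat scalerA.
(* By uniqueness of residues, the weights combine linearly in the same way as the directions. *)
have combine (k : 'I_n.+1 -> R) (m : R -> R) :
    h (\sum_i k i *: tnth A i) = \sum_(a <- undup s) m a *: P a ->
    forall a, a \in s -> \sum_i k i * w i a = m a.
  move=> E a as_; apply/subr0_eq.
  apply: (@residues_unique _ (fun a => \sum_i k i * w i a - m a) s _ a as_).
  under eq_bigr do rewrite scalerBl.
  rewrite sumrB -E hsum; apply/eqP; rewrite subr_eq0; apply/eqP.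
  under eq_bigr do rewrite scaler_suml.
  rewrite exchange_big; apply: eq_bigr => i _ /=.
  by rewrite Ew scaler_sumr; apply: eq_bigr => b _; rewrite scalerA.
have row a : a \in s -> \sum_i w i a = (count_mem a s)%:R.
  move=> as_.
  apply: etrans (@combine (fun=> 1) (fun a => (count_mem a s)%:R) _ a as_).
    by apply: eq_bigr => i _; rewrite mul1r.
  by rewrite -he -sumA; congr h; apply: eq_bigr => i _; rewrite scale1r.
have mean a : a \in s -> \sum_i r i 0 * w i a = (count_mem a s)%:R * a.
  exact: (@combine (fun i => r i 0) (fun a => (count_mem a s)%:R * a) hx).
(* Coefficients of degree [n] are compared: each [P a] is monic of that degree, and the left side
   yields the trace. *)
have col i : \sum_(a <- undup s) w i a = 1.
  have := congr1 (fun q : {poly R} => q`_n) (Ew i).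
  rewrite /h coefZ (coef_dcharp_lead hyp) mulKf // (proj2 (dsA i)) => ->.
  rewrite coef_sum big_seq [RHS]big_seq; apply: eq_bigr => a.
  by rewrite mem_undup => as_; rewrite coefZ coef_prodX_rem ?mulr1.
have sum_eig (f : R -> R) : \sum_i f (eigenvalues n.+1 p e x i 0) =
    \sum_(a <- undup s) (count_mem a s)%:R * f a.
  transitivity (\sum_(a <- s) f a).
    by rewrite [RHS](big_nth 0) sz big_mkord; apply: eq_bigr => i _; rewrite Eeig.
  by rewrite sum_undup_count; apply: eq_bigr => a _; rewrite mulr_natl.
have sum_w (f : 'I_n.+1 -> R) :
    \sum_(a <- undup s) \sum_i f i * w i a = \sum_i f i.
  rewrite exchange_big; apply: eq_bigr => i _ /=.
  by rewrite -mulr_sumr col mulr1.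
apply: majorized_hinge => [|T].
  rewrite (sum_eig id) -sum_w big_seq [RHS]big_seq; apply: eq_bigr => a.
  by rewrite mem_undup => /mean ->.
rewrite (sum_eig (fun a => Num.max (a - T) 0)) -sum_w.
rewrite big_seq [leRHS]big_seq; apply: ler_sum => a; rewrite mem_undup => as_.
(* With [m] the multiplicity of [a], [m (a - T) = sum_i w_i(a) (r_i - T)]; the weights are
   nonnegative, so passing to positive parts only increases the right side. *)
rewrite maxr_pMr ?ler0n // mulr0 ge_max; apply/andP; split; last first.
  by apply: sumr_ge0 => i _; rewrite mulr_ge0 ?w0 // le_max lexx orbT.
rewrite mulrBr -mean // -row // mulr_suml -sumrB; apply: ler_sum => i _.
by rewrite [w i a * T]mulrC -mulrBl ler_wpM2r ?w0 // le_max lexx.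
Qed.

Theorem theorem5p2 (R : realType) (V : vectType R) (n : nat)
    (p : vpoly V) (e : V) (hyp : hyperbolic_system n p e) (A : n.-tuple V) :
  (doubly_stochastic p e A ->
     forall r : 'cV[R]_n, majorized (eigenvalues n p e (Vmatrix_mul A r)) r) /\
  (complete n p e ->
     (forall r : 'cV[R]_n,
        majorized (eigenvalues n p e (Vmatrix_mul A r)) r) ->
     doubly_stochastic p e A).
Proof.
split=> [dsA r|]; first exact: doubly_stochastic_majorized.
exact: majorized_doubly_stochastic.
Qed.
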